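(* Let $G$ be a finite nilpotent group and $H$ a subgroup of $G$. Then $H$ is a perfect code of $G$ if and only if the Sylow $2$-subgroup of $H$ is a perfect code of $G$.
   Context: For a finite group $G$ with identity $1$ and a subset $S\subseteq G\setminus\{1\}$ with $S^{-1}=S$ (possibly $S=\emptyset$), the Cayley graph $\mathrm{Cay}(G,S)$ has vertex set $G$, with $x,y$ adjacent if and only if $yx^{-1}\in S$. A perfect code in a graph $\Gamma$ with vertex set $V$ is a subset $C\subseteq V$ such that no two vertices of $C$ are adjacent and every vertex in $V\setminus C$ is adjacent to exactly one vertex in $C$. A subset (in particular a subgroup) $C$ of $G$ is called a perfect code of $G$ if there exists such an $S$ for which $C$ is a perfect code in $\mathrm{Cay}(G,S)$. *)

(* Defs.v *)
From mathcomp Require Import all_boot all_fingroup all_solvable.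

Set Implicit Arguments.
Unset Strict Implicit.
Unset Printing Implicit Defensive.

Local Open Scope group_scope.

Definition perfect_code_graph (T : finType) (V : {set T}) (adj : rel T)
    (C : {set T}) : Prop :=
  [/\ C \subset V,
      {in C &, forall x y, ~~ adj x y}
    & {in V :\: C, forall x, #|[set y in C | adj x y]| = 1%N}].

(* [S^-1] is the pointwise inverse; [S] may be empty. *)
Definition connection_set (gT : finGroupType) (G S : {set gT}) : Prop :=
  S \subset G :\ 1 /\ S^-1 = S.

Definition cayley_adj (gT : finGroupType) (S : {set gT}) : rel gT :=
  fun x y => y * x^-1 \in S.

Definition perfect_code (gT : finGroupType) (G C : {set gT}) : Prop :=
  exists2 S : {set gT},
    connection_set G S & perfect_code_graph G (cayley_adj S) C.

(* Main.v *)
Require Import Defs.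
From mathcomp Require Import all_boot all_fingroup all_solvable.

(** For a subgroup [H], a connection set making [H] a perfect code is, up to
    adjoining the identity, a right transversal of [H] in [G] that is stable
    under inversion ([perfect_codeP]).  So the question is when such
    transversals exist.

    Write the nilpotent group [G] as [A \x B] with [A] its 2-core and [B] its
    2'-core; then [H = P \x K] with [P] in [A] and [K] in [B].  Both [H] and
    [P = P \x 1] have this shape, so it suffices that the answer for [P \x K]
    in [A \x B] does not depend on [K]: it is the answer for [P] in [A].

    An inverse-closed transversal of [P \x K] restricts to [A * K] and then
    projects onto one of [P] in [A] ([inv_transversal_dprodl]).  Conversely,
    transversals of [P] in [A] and of [K] in [B] multiply to a transversal of
    [P \x K] ([inv_transversal_dprod]), so everything comes down to the fact
    that in the group [B] of odd order every subgroup has an inverse-closed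
    transversal ([sqrt_closed_inv_transversal]).  That holds because a maximal
    inverse-closed partial transversal can miss no coset: a coset missed in
    the double coset [D] forces, by counting, another one missed in [D^-1], and
    some element of the first has its inverse in the second. *)

Set Implicit Arguments.
Unset Strict Implicit.
Unset Printing Implicit Defensive.

Local Open Scope group_scope.

Section InverseClosedTransversals.

Variable gT : finGroupType.
Implicit Types (G H A B K P : {group gT}) (T U : {set gT}).

(** * Perfect codes as inverse-closed transversals *)

(** Boolean, so that maximal such sets can be extracted from the finite type
    of subsets. *)
Definition inv_partial_transversal (G H T : {set gT}) : bool :=
  [&& T \subset G, T^-1 == T
    & [forall t in T, forall u in T, (t * u^-1 \in H) ==> (t == u)]].

Definition inv_transversal (G H T : {set gT}) : bool :=
  inv_partial_transversal G H T && (G \subset H * T).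

Lemma inv_partial_transversalP (G H T : {set gT}) :
  reflect [/\ T \subset G, T^-1 = T
            & {in T &, forall t u, t * u^-1 \in H -> t = u}]
          (inv_partial_transversal G H T).
Proof.
apply: (iffP and3P) => -[sTG invT injT]; split=> //; try exact/eqP.
  by move=> t u Tt Tu tuH; apply/eqP; move/forall_inP/(_ t Tt)/forall_inP: injT
    => /(_ u Tu)/implyP; apply.
apply/forall_inP=> t Tt; apply/forall_inP=> u Tu; apply/implyP=> tuH.
by apply/eqP; apply: injT.
Qed.

Lemma mem_invset T t : T^-1 = T -> (t^-1 \in T) = (t \in T).
Proof. by move=> invT; rewrite -{1}invT memV_invg. Qed.

(** The neighbours in [H] of a vertex [x] correspond to the elements of the
    connection set in the coset [H :* x^-1], whence the transversal.  A
    transversal may represent [H] itself by an involution of [H]; only its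
    part outside [H] is used as connection set. *)
Lemma perfect_codeP G H : H \subset G ->
  perfect_code G H <-> exists T, inv_transversal G H T.
Proof.
move=> sHG; split=> [[S [sSG invS] [_ indepH domH]] | [T /andP[]]].
  have S'H s : s \in S -> s \notin H.
    move=> Ss; apply/negP=> Hs; have:= indepH 1 s (group1 H) Hs.
    by rewrite /cayley_adj invg1 mulg1 Ss.
  have sSG' s : s \in S -> s \in G by move/(subsetP sSG)/setD1P=> [].
  exists (1 |: S); apply/andP; split.
    apply/inv_partial_transversalP; split.
    - by apply/subsetP=> s /setU1P[-> | /sSG'].
    - apply/setP=> s.
      by rewrite mem_invg !in_setU1 eq_invg1 mem_invset.
    move=> t u /setU1P[-> | St] /setU1P[-> | Su] //.
    - by rewrite mul1g groupV (negPf (S'H u Su)).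
    - by rewrite invg1 mulg1 (negPf (S'H t St)).
    move=> tuH; have: u^-1 \in G :\: H.
      by rewrite inE !groupV S'H // sSG'.
    move/domH/eqP/cards1P=> [y defy].
    have /set1P ey: 1 \in [set y].
      by rewrite -defy inE group1 /cayley_adj invgK mul1g.
    have /set1P: t * u^-1 \in [set y].
      by rewrite -defy inE tuH /cayley_adj invgK mulgKV.
    by rewrite -ey => /eqP; rewrite -eq_mulgV1 => /eqP.
  apply/subsetP=> x Gx; have [Hx | H'x] := boolP (x \in H).
    by rewrite -(mulg1 x) mem_mulg // setU11.
  have: x^-1 \in G :\: H by rewrite inE !groupV H'x.
  move/domH/eqP/cards1P=> [y defy].
  have: y \in [set y] by rewrite set11.
  rewrite -defy inE /cayley_adj invgK => /andP[Hy Syx].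
  by rewrite -(mulKg y x) mem_mulg ?groupV // inE Syx orbT.
case/inv_partial_transversalP=> sTG invT injT covT.
exists (T :\: H).
  split.
    apply/subsetP=> t /setDP[Tt H't]; rewrite !inE (subsetP sTG) // andbT.
    by apply: contraNneq H't => ->.
  by apply/setP=> t; rewrite mem_invg !inE groupV mem_invset.
split=> // [x y Hx Hy | x /setDP[Gx H'x]].
  by rewrite /cayley_adj inE groupM ?groupV.
have /(subsetP covT)/mulsgP[h t Hh Tt defx]: x^-1 \in G by rewrite groupV.
apply/eqP/cards1P; exists h^-1; apply/setP=> y; rewrite /cayley_adj !inE.
apply/and3P/eqP=> [[Hy _ Tyx] | ->].
  have: y * x^-1 = t.
    by apply: injT => //; rewrite defx mulgA mulgK groupM.
  by move/(canRL (mulgKV _)); rewrite -(invgK x) defx invMg mulKVg.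
by rewrite groupV Hh defx mulKg Tt -(groupMl _ Hh) -defx groupV H'x.
Qed.

(** * Transversals when no element outside the subgroup has its square inside *)

Lemma card_mul_partial_transversal H U :
  {in U &, forall t u, t * u^-1 \in H -> t = u} -> #|H * U| = (#|H| * #|U|)%N.
Proof.
move=> injU; rewrite -cardsX [H * U]curry_imset2X card_in_imset //.
move=> [h t] [k u] /setXP[/= Hh Ut] /setXP[/= Hk Uu] eq_hk.
have ett: t = u.
  apply: injU => //; rewrite -(mulKg h t) eq_hk -!mulgA mulgV mulg1.
  by rewrite groupM ?groupV.
by move: eq_hk; rewrite ett => /mulIg->.
Qed.

(** Inversion maps the part of [T] in [D = H :* x * H] onto its part in
    [D^-1], and [D], [D^-1] consist of equally many right cosets of [H]; so if
    [T] misses a coset in [D], it must miss one in [D^-1].  Such a coset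
    [H :* t^-1] can be named by a [t] in [H :* x], because [H :* x] meets every
    left coset contained in [D]. *)
Lemma missed_inverse_coset G H T x :
    H \subset G -> inv_partial_transversal G H T -> x \notin H * T ->
  exists2 t, t \in H :* x & t^-1 \notin H * T.
Proof.
move=> sHG /inv_partial_transversalP[_ invT injT] HT'x.
apply/exists_inP; apply: contraT => /exists_inPn hitT.
set D := H :* x * H; have Dx: x \in D.
  by rewrite -{1}(mulg1 x) mem_mulg ?rcoset_refl.
have HD h d : h \in H -> d \in D -> h * d \in D.
  move=> Hh /mulsgP[_ k /rcosetP[l Hl ->] Hk ->].
  by rewrite !mulgA mem_mulg ?mem_rcoset ?mulgK ?groupM.
(* No coset in D^-1 being missed, T covers all of D^-1. *)
have DV: D^-1 = H * (T :&: D^-1).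
  apply/eqP; rewrite eqEsubset; apply/andP; split; apply/subsetP=> d.
    rewrite mem_invg => Dd; case/mulsgP: (Dd) => y k Hxy Hk defd.
    have /hitT: y \in H :* x by [].
    rewrite negbK => /mulsgP[h t Hh Tt defy].
    have ed: d = k^-1 * h * t.
      by rewrite -mulgA -defy -invMg -defd invgK.
    rewrite ed mem_mulg ?groupM ?groupV // inE Tt mem_invg.
    have ->: t^-1 = d^-1 * (k^-1 * h) by rewrite ed invMg mulgKV.
    rewrite defd -mulgA mem_mulg // !groupM ?groupV //.
  case/mulsgP=> h t Hh /setIP[_ Dt] ->; move: Dt; rewrite !mem_invg invMg.
  case/mulsgP=> y k Hxy Hk ->.
  by rewrite -mulgA mem_mulg // groupM ?groupV.
have sub_inj U : {in T :&: U &, forall t u, t * u^-1 \in H -> t = u}.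
  by move=> t u /setIP[Tt _] /setIP[Tu _]; apply: injT.
(* On the other hand T does not cover D, since it misses H :* x. *)
have: #|H * (T :&: D)| < #|D|.
  apply/proper_card/properP; split.
    by apply/subsetP=> _ /mulsgP[h t Hh /setIP[_ Dt] ->]; apply: HD.
  by exists x => //; apply: contra HT'x; apply/subsetP/mulgS/subsetIl.
rewrite -(card_invg D) DV !card_mul_partial_transversal //.
by rewrite -{2}invT -invIg card_invg ltnn.
Qed.

(** The element [t] of [missed_inverse_coset] lets [t] and [t^-1] be added to a
    partial transversal, unless they lie in the same coset of [H], that is,
    unless [t ^+ 2 \in H]; the hypothesis excludes this outside [H]. *)
Lemma sqrt_closed_inv_transversal G H :
    H \subset G -> {in G, forall t, t ^+ 2 \in H -> t \in H} ->
  exists T, inv_transversal G H T.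
Proof.
move=> sHG sqrtH; pose p := inv_partial_transversal G H.
have p1: p [set 1].
  apply/inv_partial_transversalP; split; first by rewrite sub1set.
    by rewrite invg_set1 invg1.
  by move=> t u /set1P-> /set1P->.
(* Starting from the identity ensures that H itself is not a missed coset, so
   that the t below lies outside H. *)
have [T /maxsetP[pT maxT]] := maxset_exists p1; rewrite sub1set => T1.
exists T; apply/andP; split=> //; apply/subsetP=> x Gx; apply: contraT => HT'x.
have [t Hxt HT'V] := missed_inverse_coset sHG pT HT'x.
have Gt: t \in G.
  by case/rcosetP: Hxt => h Hh ->; rewrite groupM // (subsetP sHG).
have HT't: t \notin H * T.
  apply: contra HT'x => /mulsgP[h u Hh Tu deft].
  case/rcosetP: Hxt => k Hk; rewrite deft => /(canLR (mulKg k)) <-.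
  by rewrite mulgA mem_mulg // groupM ?groupV.
case/inv_partial_transversalP: (pT) => sTG invT injT.
have H't: t \notin H by apply: contra HT't => Ht; rewrite -(mulg1 t) mem_mulg.
have missed v u : v \notin H * T -> u \in T -> v * u^-1 \notin H.
  by move=> HT'v Tu; apply: contra HT'v => Hvu; rewrite -(mulgKV u v) mem_mulg.
have H'sq: t * t \notin H by apply: contra H't => /(sqrtH _ Gt).
have new v u : v \in [set t; t^-1] -> u \in T -> v * u^-1 \notin H.
  by case/set2P=> -> Tu; apply: missed.
have eqT: [set t; t^-1] :|: T = T.
  apply: maxT; last exact: subsetUr.
  apply/inv_partial_transversalP; split.
  - by rewrite subUset sTG andbT; apply/subsetP=> _ /set2P[]->; rewrite ?groupV.
  - apply/setP=> u; rewrite mem_invg !inE mem_invset //.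
    by rewrite (inj_eq invg_inj) eq_invg_sym [X in X || _ = _]orbC.
  move=> v u /setUP[nv | Tv] /setUP[nu | Tu].
  - case/set2P: nv => ->; case/set2P: nu => -> //; rewrite ?invgK.
      by rewrite (negPf H'sq).
    by rewrite -invMg groupV (negPf H'sq).
  - by rewrite (negPf (new v u nv Tu)).
  - by rewrite -groupV invMg invgK (negPf (new u v nu Tv)).
  exact: injT.
have Tt: t \in T by rewrite -eqT !inE eqxx.
by case/negP: HT't; rewrite -(mul1g t) mem_mulg.
Qed.

Lemma odd_sqrt_closed G H :
  odd #|G| -> {in G, forall t, t ^+ 2 \in H -> t \in H}.
Proof.
move=> oddG t Gt Ht2; have odd_t: coprime #[t] 2.
  by rewrite coprimen2 (dvdn_odd (order_dvdG Gt)).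
have: t \in <[t ^+ 2]>.
  have: generator <[t]> (t ^+ 2) by rewrite generator_coprime.
  by move/eqP <-; apply: cycle_id.
by apply/subsetP; rewrite cycle_subG.
Qed.

(** * Direct products *)

Section DirectProduct.

Variables (A B P K G H : {group gT}).
Hypotheses (defG : A \x B = G) (sPA : P \subset A) (sKB : K \subset B).
Hypothesis defH : P \x K = H.

Let mulAB : A * B = G. Proof. by case/dprodP: defG. Qed.
Let mulPK : P * K = H. Proof. by case/dprodP: defH. Qed.

Let commAB a b : a \in A -> b \in B -> commute a b.
Proof. by case/dprodP: defG => _ _ /centsP cBA _ Aa Bb; apply/commute_sym/cBA. Qed.

Let divAB a b c d :
  b \in B -> c \in A -> d \in B -> a * b * (c * d)^-1 = a * c^-1 * (b * d^-1).
Proof.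
move=> Bb Ac Bd; have c_bd: commute c^-1 (b * d^-1).
  by apply: commAB; rewrite ?groupM ?groupV.
by rewrite -(mulgA a c^-1) c_bd invMg !mulgA.
Qed.

Let injAB a b c d :
  a \in A -> b \in B -> c \in A -> d \in B -> a * b = c * d -> a = c /\ b = d.
Proof.
move=> Aa Bb Ac Bd eq_abcd; have [_ _ _ tiAB] := dprodP defG.
have eac: c^-1 * a = d * b^-1.
  by apply: (mulIg b); rewrite -mulgA eq_abcd mulKg mulgKV.
have: c^-1 * a \in A :&: B.
  by rewrite inE {2}eac !groupM ?groupV.
rewrite tiAB => /set1P/eqP; rewrite -eq_mulVg1 => /eqP eca.
by move: eq_abcd; rewrite eca => /mulgI.
Qed.

(** The cosets of [H] meeting [A * K] correspond to the cosets of [P] in [A] by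
    projection along [K], and this projection commutes with inversion. *)
Lemma inv_transversal_dprodl T :
  inv_transversal G H T -> exists U, inv_transversal A P U.
Proof.
case/andP=> /inv_partial_transversalP[_ invT injT] covT.
exists [set a in A | [exists b in K, a * b \in T]].
apply/andP; split; first apply/inv_partial_transversalP; first split.
- by apply/subsetP=> a /[!inE]/andP[].
- have V a : a \in [set a in A | [exists b in K, a * b \in T]] ->
             a^-1 \in [set a in A | [exists b in K, a * b \in T]].
    rewrite !inE groupV => /andP[Aa /exists_inP[b Kb Tab]]; rewrite Aa /=.
    have Bb := subsetP sKB b Kb.
    apply/exists_inP; exists b^-1; rewrite ?groupV //.
    by rewrite -invMg -(commAB Aa Bb) mem_invset.
  apply/setP=> a; rewrite mem_invg; apply/idP/idP=> /V //.
  by rewrite invgK.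
- move=> a c /[!inE] /andP[Aa /exists_inP[b Kb Tab]].
  move=> /andP[Ac /exists_inP[d Kd Tcd]] Pac.
  have [Bb Bd] := (subsetP sKB b Kb, subsetP sKB d Kd).
  have /(injT _ _ Tab Tcd)/injAB[] // : a * b * (c * d)^-1 \in H.
  by rewrite divAB // -mulPK mem_mulg // groupM ?groupV.
apply/subsetP=> x Ax; have: x \in H * T.
  by rewrite (subsetP covT) // -mulAB -(mulg1 x) mem_mulg.
case/mulsgP=> h t; rewrite -mulPK => /mulsgP[p k Pp Kk ->] Tt defx.
have [Ap Bk] := (subsetP sPA p Pp, subsetP sKB k Kk).
have deft: t = p^-1 * x * k^-1.
  rewrite -mulgA (commAB Ax) ?groupV // defx (commAB Ap Bk).
  by rewrite -!mulgA !mulKg.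
rewrite -(mulKVg p x) mem_mulg // inE groupM ?groupV //=.
by apply/exists_inP; exists k^-1; rewrite ?groupV // -deft.
Qed.

Lemma inv_transversal_dprod T U :
  inv_transversal A P T -> inv_transversal B K U -> inv_transversal G H (T * U).
Proof.
case/andP=> /inv_partial_transversalP[sTA invT injT] covT.
case/andP=> /inv_partial_transversalP[sUB invU injU] covU.
have cTU : T * U = U * T.
  apply/centC/centsP => t Tt u Uu.
  by apply: commAB; [apply: (subsetP sTA) | apply: (subsetP sUB)].
apply/andP; split; first apply/inv_partial_transversalP; first split.
- by rewrite -mulAB mulgSS.
- by rewrite invMg invT invU.
- move=> _ _ /mulsgP[t u Tt Uu ->] /mulsgP[v w Tv Uw ->].
  have [At Bu] := (subsetP sTA t Tt, subsetP sUB u Uu).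
  have [Av Bw] := (subsetP sTA v Tv, subsetP sUB w Uw).
  rewrite divAB // -mulPK => /mulsgP[p k Pp Kk].
  have [Ap Bk] := (subsetP sPA p Pp, subsetP sKB k Kk).
  case/injAB; rewrite ?groupM ?groupV // => etv euw.
  by congr (_ * _); [apply: injT | apply: injU]; rewrite ?etv ?euw.
apply/subsetP=> x; rewrite -mulAB => /mulsgP[a b].
case/(subsetP covT)/mulsgP=> p t Pp Tt -> /(subsetP covU)/mulsgP[k u Kk Uu ->] ->.
have tk: commute t k.
  by apply: commAB; [apply: (subsetP sTA) | apply: (subsetP sKB)].
have ->: p * t * (k * u) = p * k * (t * u).
  by rewrite -!mulgA (mulgA t) tk !mulgA.
by rewrite -mulPK !mem_mulg.
Qed.

Lemma perfect_code_dprod_odd :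
  odd #|B| -> perfect_code G H <-> perfect_code A P.
Proof.
move=> oddB; have sHG : H \subset G by rewrite -mulPK -mulAB mulgSS.
split=> [/(perfect_codeP sHG)[T trT] | /(perfect_codeP sPA)[T trT]].
  exact/(perfect_codeP sPA)/inv_transversal_dprodl/trT.
have [U trU] := sqrt_closed_inv_transversal sKB (odd_sqrt_closed oddB).
by apply/(perfect_codeP sHG); exists (T * U); apply: inv_transversal_dprod.
Qed.

End DirectProduct.

End InverseClosedTransversals.

(** * Nilpotent groups *)

Theorem theorem5p3 (gT : finGroupType) (G H P : {group gT})
    (nilG : nilpotent G) (sHG : H \subset G) (sylP : 2.-Sylow(H) P) :
  perfect_code G H <-> perfect_code G P.
Proof.
have nilH := nilpotentS sHG nilG.
have defP : P :=: 'O_2(H) := nilpotent_Hall_pcore nilH sylP.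
have defG := nilpotent_pcoreC 2 nilG.
have defH : P \x 'O_2^'(H) = H by rewrite defP nilpotent_pcoreC.
have sub_core pi : 'O_pi(H) \subset 'O_pi(G).
  rewrite (sub_normal_Hall (nilpotent_pcore_Hall pi nilG)) ?pcore_normal //.
    exact: pcore_pgroup.
  exact: subset_trans (pcore_sub _ _) sHG.
have sPA : P \subset 'O_2(G) by rewrite defP.
have oddB : odd #|'O_2^'(G)| by rewrite odd_2'nat; apply: pcore_pgroup.
have iffH := perfect_code_dprod_odd defG sPA (sub_core 2^') defH oddB.
have iffP := perfect_code_dprod_odd defG sPA (sub1G _) (dprodg1 P) oddB.
exact: iff_trans iffH (iff_sym iffP).
Qed.
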